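(* Let $G=(V,E)$ be a finite multigraph and let $t\colon V\to\mathbb{N}$ be a function. Then $$\chi^t(G)\,\leq\,\max_{uv\in E}\Bigl(\max(d(u),d(v))+\bigl\lfloor\tfrac{1}{2}\min(d(u),d(v))\bigr\rfloor+t(u)+t(v)\Bigr).$$ In particular, if $t$ is constant, then $$\chi^t(G)\,\leq\,\bigl\lfloor\tfrac{3}{2}\Delta(G)\bigr\rfloor+2t.$$
   Context: $\mathbb{N}=\{0,1,2,\dots\}$, $\mathbb{Z}^+=\{1,2,\dots\}$, and $\mathcal{P}(\mathbb{Z}^+)$ is the power set of $\mathbb{Z}^+$. A multigraph $G=(V,E)$ may have several parallel edges between two vertices, but every edge $uv=\{u,v\}$ has two distinct ends (no loops). $d(v)$ is the degree of the vertex $v$ (number of edges incident with $v$, counted with multiplicity) and $\Delta(G)$ is the maximal degree. An edge coloring is a map $c'\colon E\to\{1,\dots,m\}$ with $c'(e)\neq c'(f)$ for any two distinct edges $e,f$ sharing at least one end. For a multi-labeling $c\colon V\to\mathcal{P}(\mathbb{Z}^+)$, an edge coloring $c'$ avoids $c$ if $c'(e)\notin\bigcup_{v\in e}c(v)$ for every $e\in E$. The $c$-avoiding chromatic index $\chi'_c(G)$ is the smallest $m\in\mathbb{N}$ for which there is an edge coloring $c'\colon E\to\{1,\dots,m\}$ that avoids $c$ (so it is $0$ if $E=\emptyset$). For $t\colon V\to\mathbb{N}$, a $t$-labeling is a multi-labeling $c\colon V\to\mathcal{P}(\mathbb{Z}^+)$ with $|c(v)|\le t(v)$ for all $v\in V$;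 a constant function is identified with its value. The $t$-avoiding chromatic index is $\chi^t(G):=\max\{\chi'_c(G) : c \text{ is a } t\text{-labeling}\}$. The maximum over an empty edge set is taken to be $0$. *)

(* Defs.v *)
From mathcomp Require Import all_boot.
From mathcomp Require Import boolp classical_sets functions cardinality.

Set Implicit Arguments.
Unset Strict Implicit.
Unset Printing Implicit Defensive.

(* Parallel edges are distinct elements of [edge] with the same set of ends. *)
Record multigraph := Multigraph {
  vertex : finType;
  edge : finType;
  ends : edge -> {set vertex};
  card_ends : forall e, #|ends e| = 2
}.

Definition joined (G : multigraph) (u v : vertex G) : bool :=
  [exists e : edge G, ends e == [set u; v]].

Definition degree (G : multigraph) (v : vertex G) : nat :=
  #|[set e : edge G | v \in ends e]|.

Definition max_degree (G : multigraph) : nat :=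
  \max_(v : vertex G) degree v.

Definition edge_coloring (G : multigraph) (m : nat) (c' : edge G -> nat) :=
  (forall e : edge G, 1 <= c' e <= m) /\
  (forall (e f : edge G) (v : vertex G),
     e <> f -> v \in ends e -> v \in ends f -> c' e <> c' f).

(* Labels are subsets of nat; that they consist of positive integers is part
   of [t_labeling]. *)
Definition avoids (G : multigraph) (c : vertex G -> set nat)
    (c' : edge G -> nat) :=
  forall e : edge G, ~ (\bigcup_(v in [set` ends e]) c v)%classic (c' e).

Definition avoiding_colorable (G : multigraph) (c : vertex G -> set nat)
    (m : nat) :=
  exists c', edge_coloring m c' /\ avoids c c'.

Definition is_min (A : set nat) (m : nat) := A m /\ forall n, A n -> m <= n.

Definition is_max (A : set nat) (m : nat) := A m /\ forall n, A n -> n <= m.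

(* The default value 0 is only taken when no edge coloring avoids c, which
   never happens for a t-labeling: see [c_chromatic_indexP]. *)
Definition c_chromatic_index (G : multigraph) (c : vertex G -> set nat) : nat :=
  xget 0 (is_min (avoiding_colorable c)).

Definition t_labeling (G : multigraph) (t : vertex G -> nat)
    (c : vertex G -> set nat) :=
  forall v, (c v `<=` [set k | 0 < k])%classic /\ (c v #<= `I_(t v))%card.

(* The maximum always exists, so that the default value 0 is irrelevant: see
   [t_chromatic_indexP]. *)
Definition t_chromatic_index (G : multigraph) (t : vertex G -> nat) : nat :=
  xget 0 (is_max [set c_chromatic_index c | c in t_labeling t]%classic).

Lemma size_uniq_card_le (A : set nat) (n : nat) (s : seq nat) :
  (A #<= `I_n)%card -> uniq s -> (forall x, x \in s -> A x) -> size s <= n.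
Proof.
move=> /pcard_leP[f] us sA.
have := @uniq_leq_size _ (map f s) (iota 0 n).
rewrite size_map size_iota; apply.
  rewrite map_inj_in_uniq // => x y xs ys.
  by apply: inj; rewrite inE; apply: sA.
move=> _ /mapP[x xs ->]; rewrite mem_iota /= add0n.
exact: (@funS _ _ _ _ f _ (sA _ xs)).
Qed.

Lemma t_labeling_colorable (G : multigraph) (t : vertex G -> nat)
    (c : vertex G -> set nat) :
  t_labeling t c ->
  avoiding_colorable c (#|edge G| + \sum_(v : vertex G) t v).
Proof.
move=> tc; set m := _ + _.
pose bad k := [exists v : vertex G, `[< c v k >]].
pose s := [seq k <- iota 1 m | ~~ bad k].
have count_bad : count bad (iota 1 m) <= \sum_(v : vertex G) t v.
  apply: (@leq_trans (\sum_(v : vertex G) count (fun k => `[< c v k >])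
                        (iota 1 m))).
    elim: (iota 1 m) => [|k l IH] //=.
    rewrite big_split /= leq_add //.
    case: (boolP (bad k)) => // /existsP[v cvk].
    by rewrite (bigD1 v) //= cvk.
  apply: leq_sum => v _; rewrite -size_filter.
  have [_ cv] := tc v; apply: (size_uniq_card_le cv).
    exact/filter_uniq/iota_uniq.
  by move=> x; rewrite mem_filter => /andP[/asboolP].
have le_s : #|edge G| <= size s.
  rewrite size_filter -(leq_add2l (count bad (iota 1 m))) count_predC.
  by rewrite size_iota /m addnC leq_add2l.
have lt_s (e : edge G) : enum_rank e < size s by apply: leq_trans le_s.
have us : uniq s by exact/filter_uniq/iota_uniq.
exists (fun e => nth 0 s (enum_rank e)); split; first split.
- move=> e; have := mem_nth 0 (lt_s e).
  by rewrite mem_filter mem_iota add1n ltnS => /andP[].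
- move=> e f v ef _ _ /eqP; rewrite nth_uniq // => /eqP /ord_inj.
  by move=> /enum_rank_inj.
- move=> e [v _ cv]; have := mem_nth 0 (lt_s e).
  rewrite mem_filter => /andP[/existsP nb _]; apply: nb.
  by exists v; apply/asboolP.
Qed.

Lemma exists_min (A : set nat) (n : nat) : A n -> exists m, is_min A m.
Proof.
move=> An; have exA : exists k, `[< A k >] by exists n; apply/asboolP.
case: (ex_minnP exA) => m /asboolP Am mmin.
by exists m; split=> // k Ak; apply/mmin/asboolP.
Qed.

Lemma exists_max (A : set nat) (n b : nat) :
  A n -> (forall k, A k -> k <= b) -> exists m, is_max A m.
Proof.
move=> An Ab; have exA : exists k, `[< A k >] by exists n; apply/asboolP.
have bA k : `[< A k >] -> k <= b by move=> /asboolP; apply: Ab.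
case: (ex_maxnP exA bA) => m /asboolP Am mmax.
by exists m; split=> // k Ak; apply/mmax/asboolP.
Qed.

Lemma c_chromatic_indexP (G : multigraph) (t : vertex G -> nat)
    (c : vertex G -> set nat) :
  t_labeling t c -> is_min (avoiding_colorable c) (c_chromatic_index c).
Proof.
by move=> /t_labeling_colorable /exists_min exA; apply: xgetPex.
Qed.

Lemma t_chromatic_indexP (G : multigraph) (t : vertex G -> nat) :
  is_max [set c_chromatic_index c | c in t_labeling t]%classic
    (t_chromatic_index t).
Proof.
apply: xgetPex.
apply: (@exists_max _ (c_chromatic_index (fun _ : vertex G => set0))
          (#|edge G| + \sum_(v : vertex G) t v)).
  by exists (fun=> set0) => // v; split; [exact: sub0set|exact: card_ge0].
move=> _ [c tc <-]; have [_] := c_chromatic_indexP tc; apply.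
exact: t_labeling_colorable.
Qed.

(* Main.v *)
Require Import Defs.
From mathcomp Require Import boolp classical_sets.
From mathcomp Require Import all_boot zify.

(* The theorem follows from the list edge coloring theorem of Borodin, Kostochka
   and Woodall, with the labels allowed at both ends of an edge as its list.
   By Galvin's kernel argument, a bipartite multigraph is colorable from lists
   longer than the number of edges preferred to an edge at either end. Ranking
   the edges at each vertex so that this number is below [max(d(x),d(y))] is
   done by induction: on the side with at least as many vertices, say that of
   [x], choose a minimal nonempty set [T] with at most [#|T|] neighbours of at
   least the same degree. By Hall's theorem there is a matching between them,
   which can be made the first choice at [x] and the last choice at [y].
   In general, the edges outside a maximum cut have at most half of the degree
   at each vertex; color them first by induction, then color the bipartite cut
   from what remains of the lists. *)

Set Implicit Arguments.
Unset Strict Implicit.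
Unset Printing Implicit Defensive.

Section Bipartite.

Variables (E : finType).
Implicit Types (F M K : {set E}).

(** * Hall's theorem and saturating matchings *)

Section OneSide.
Variables (VX VY : finType) (px : E -> VX) (py : E -> VY).

Definition nbhd F (S : {set VX}) : {set VY} :=
  py @: [set e in F | px e \in S].

Definition is_matching M := {in M &, injective px} /\ {in M &, injective py}.

Lemma nbhdS F (S1 S2 : {set VX}) : S1 \subset S2 -> nbhd F S1 \subset nbhd F S2.
Proof.
move=> S12; apply: imsetS; apply/subsetP => e; rewrite !inE => /andP[-> /=].
exact: (subsetP S12).
Qed.

Lemma mem_nbhd F (S : {set VX}) e : e \in F -> px e \in S -> py e \in nbhd F S.
Proof. by move=> eF eS; apply: imset_f; rewrite inE eF. Qed.

(* Rado's proof: if two edges share a [px]-end, then one of them can be deleted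
   without destroying Hall's condition, since [nbhd F] is submodular. *)
Lemma hall F (T : {set VX}) :
  (forall S : {set VX}, S \subset T -> #|S| <= #|nbhd F S|) ->
  exists M, [/\ M \subset F, is_matching M & px @: M = T].
Proof.
have [n] := ubnP #|F|; elim: n F => // n IH F /ltnSE leFn hallF.
have [/existsP[e1 /existsP[e2 /and5P[e1F e2F e12 px12 e1T]]]|no2] := boolP
    [exists e1, exists e2,
      [&& e1 \in F, e2 \in F, e1 != e2, px e1 == px e2 & px e1 \in T]].
  have bad e : e \in F -> (forall S : {set VX}, S \subset T ->
      #|S| <= #|nbhd (F :\ e) S|) ->
      exists M, [/\ M \subset F, is_matching M & px @: M = T].
    move=> eF /IH[|M [MF matM pxM]].
      by move: leFn; rewrite (cardsD1 e) eF.
    by exists M; split=> //; apply: subset_trans MF (subD1set _ _).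
  pose deficient e := [exists S : {set VX},
    (S \subset T) && (#|nbhd (F :\ e) S| < #|S|)].
  have defP e : ~~ deficient e -> forall S : {set VX}, S \subset T ->
      #|S| <= #|nbhd (F :\ e) S|.
    rewrite negb_exists => /forallP nd S ST.
    by have := nd S; rewrite ST /= -leqNgt.
  have [/existsP[S1 /andP[S1T lt1]]|nd1] := boolP (deficient e1);
    last exact: bad (defP _ nd1).
  have [/existsP[S2 /andP[S2T lt2]]|nd2] := boolP (deficient e2);
    last exact: bad (defP _ nd2).
  (* A set that becomes deficient when [e] is deleted contains [px e]; otherwise its neighbourhood
     would not shrink. *)
  have inS (e : E) (S : {set VX}) :
      S \subset T -> #|nbhd (F :\ e) S| < #|S| -> px e \in S.
    move=> ST ltS; apply: contraLR ltS => eS; rewrite -leqNgt.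
    apply: leq_trans (hallF S ST) (subset_leq_card _).
    apply: imsetS; apply/subsetP => f; rewrite !inE => /andP[-> fS].
    by rewrite fS !andbT; apply: contraNneq eS => <-.
  have xS1 := inS _ _ S1T lt1; have xS2 := inS _ _ S2T lt2.
  rewrite -(eqP px12) in xS2.
  have leU : #|S1 :|: S2| <= #|nbhd (F :\ e1) S1 :|: nbhd (F :\ e2) S2|.
    apply: leq_trans (hallF _ _) (subset_leq_card _).
      by rewrite subUset S1T.
    apply/subsetP => _ /imsetP[e + ->]; rewrite !inE => /andP[eF].
    have [->|ne1] := eqVneq e e1.
      by move=> _; apply/orP; right; apply: mem_nbhd; rewrite // !inE e12.
    have [->|ne2] := eqVneq e e2.
      move=> _; apply/orP; left; apply: mem_nbhd; rewrite -?(eqP px12) //.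
      by rewrite !inE eq_sym e12.
    by case/orP => eS; apply/orP; [left|right]; apply: mem_nbhd;
      rewrite // !inE ?ne1 ?ne2.
  have leI : #|(S1 :&: S2) :\ px e1|
      <= #|nbhd (F :\ e1) S1 :&: nbhd (F :\ e2) S2|.
    apply: leq_trans (hallF _ _) (subset_leq_card _).
      apply: subset_trans (subD1set _ _) _.
      by apply: subset_trans (subsetIl _ _) S1T.
    apply/subsetP => _ /imsetP[e + ->]; rewrite !inE => /and4P[eF nx eS1 eS2].
    have ne1 : e != e1 by apply: contraNneq nx => ->.
    have ne2 : e != e2 by apply: contraNneq nx => ->; rewrite eq_sym.
    by rewrite !mem_nbhd // !inE ?ne1 ?ne2.
  (* Submodularity gives the two neighbourhoods total size at least [#|S1| + #|S2| - 1], but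
     deficiency allows at most [#|S1| + #|S2| - 2]. *)
  have := cardsUI S1 S2; rewrite (cardsD1 (px e1) (S1 :&: S2)) !inE xS1 xS2.
  have := cardsUI (nbhd (F :\ e1) S1) (nbhd (F :\ e2) S2).
  lia.
(* Now a vertex of [T] has at most one edge. Hall's condition on singletons yields that edge, and on
   pairs it separates the [py]-ends. *)
have uniq_edge e f : e \in F -> f \in F -> px e \in T -> px e = px f -> e = f.
  move=> eF fF eT ef; apply: contraNeq no2 => nef.
  apply/existsP; exists e; apply/existsP; exists f.
  by rewrite eF fF nef eT ef eqxx.
exists [set e in F | px e \in T]; split.
- by apply/subsetP => e; rewrite inE => /andP[].
- split=> e f; rewrite !inE => /andP[eF eT] /andP[fF fT] ef.
    exact: uniq_edge.
  apply: contraTeq (hallF [set px e; px f] _) => [nef|]; last first.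
    by apply/subsetP => z /set2P[] ->.
  rewrite cards2 (contra_neq (uniq_edge e f eF fF eT)) //.
  rewrite -leqNgt [nat_of_bool _]/= -(cards1 (py e)).
  apply: subset_leq_card; apply/subsetP.
  move=> _ /imsetP[g + ->]; rewrite !inE => /andP[gF].
  by case/orP=> /eqP gg; [rewrite (uniq_edge e g)|rewrite ef (uniq_edge f g)].
- apply/setP => x; apply/imsetP/idP => [[e]|xT].
    by rewrite inE => /andP[_ eT] ->.
  have := hallF [set x]; rewrite cards1 sub1set xT => /(_ isT).
  case/card_gt0P=> _ /imsetP[e + _]; rewrite !inE => /andP[eF /eqP ex].
  by exists e; rewrite // inE eF ex.
Qed.

Definition deg (V : finType) (p : E -> V) F (v : V) : nat :=
  #|[set e in F | p e == v]|.

(* A minimal nonempty [T] having at most [#|T|] neighbours of at least the same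
   degree satisfies Hall's condition, unless it is a vertex without such
   neighbours, and then any edge at that vertex will do. *)
Lemma exists_saturating_matching F : F != set0 -> #|py @: F| <= #|px @: F| ->
  exists M, [/\ M \subset F, M != set0, is_matching M &
    {in F, forall e, px e \in px @: M ->
      deg px F (px e) <= deg py F (py e) -> py e \in py @: M}].
Proof.
move=> F0 leYX.
pose H := [set e in F | deg px F (px e) <= deg py F (py e)].
have HF : H \subset F by apply/subsetP => e; rewrite inE => /andP[].
pose P (T : {set VX}) :=
  [&& T \subset px @: F, T != set0 & #|nbhd H T| <= #|T|].
have PX : P (px @: F).
  rewrite /P subxx imset_eq0 F0 /=; apply: leq_trans leYX.
  apply: subset_leq_card; apply: imsetS; apply/subsetP => e.
  rewrite inE => /andP[eH _].
  exact: (subsetP HF).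
case: (arg_minnP (fun T : {set VX} => #|T|) PX) => T /and3P[TX T0 leT] minT.
have hallT (S : {set VX}) : S \subset T -> S != T -> #|S| <= #|nbhd H S|.
  move=> ST neST; have [->|S0] := eqVneq S set0; first by rewrite cards0.
  apply: contraTT (proper_card (_ : S \proper T)) => [|]; last first.
    by rewrite properEneq neST.
  rewrite -ltnNge -leqNgt => /ltnW ltS; apply: minT.
  by rewrite /P S0 ltS (subset_trans ST).
have [leTN|ltTN] := leqP #|T| #|nbhd H T|.
  have [|M [MH matM pxM]] := @hall H T.
    by move=> S ST; have [->//|/hallT ->] := eqVneq S T.
  have MF := subset_trans MH HF.
  exists M; split=> //.
    by apply: contra_neq T0 => M0; rewrite -pxM M0 imset0.
  (* The matched [py]-ends lie in [nbhd H T] and number [#|T|], which is at least its size. *)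
  move=> e eF eT led; suff -> : py @: M = nbhd H T.
    by rewrite mem_nbhd // -?pxM // inE eF.
  apply/eqP; rewrite eqEcard; apply/andP; split.
    apply/subsetP => _ /imsetP[f fM ->].
    by rewrite mem_nbhd ?(subsetP MH) // -pxM imset_f.
  case: matM => injx injy.
  by rewrite (card_in_imset injy) -(card_in_imset injx) pxM.
have /set0Pn[x xT] := T0.
(* Since [T] has fewer neighbours than elements, dropping [x] would otherwise leave a smaller
   nonempty set satisfying [P]. *)
have T1 : T = [set x].
  apply/eqP; rewrite eqEsubset sub1set xT andbT -setD_eq0.
  apply: contraTT ltTN => D0; rewrite -leqNgt (cardsD1 x) xT add1n.
  have DT : T :\ x \subset T by apply: subD1set.
  rewrite ltnNge; apply/negP => leD.
  have : P (T :\ x).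
    rewrite /P D0 (subset_trans DT TX) /=.
    apply: leq_trans (subset_leq_card (nbhdS H DT)) leD.
  by move/minT; rewrite (cardsD1 x T) xT add1n ltnn.
have NT0 : nbhd H T = set0.
  by apply/eqP; move: ltTN; rewrite T1 cards1 ltnS leqn0 cards_eq0.
have /imsetP[e0 e0F xe0] := subsetP TX x xT.
exists [set e0]; split.
- by rewrite sub1set.
- by rewrite -card_gt0 cards1.
- by split=> e f /set1P-> /set1P->.
- move=> e eF; rewrite imset_set1 inE => /eqP ee0 led.
  have : py e \in nbhd H T by rewrite mem_nbhd // ?inE ?eF // T1 ee0 xe0 set11.
  by rewrite NT0 inE.
Qed.

End OneSide.

(** * Balanced rankings and kernels *)

Lemma deg_setDmatching (V : finType) (p : E -> V) F M v :
  M \subset F -> {in M &, injective p} ->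
  deg p F v = deg p (F :\: M) v + (v \in p @: M).
Proof.
move=> MF injp; rewrite /deg -(cardsID M [set e in F | p e == v]) addnC.
congr (_ + _); first by apply: eq_card => e; rewrite !inE andbA.
have [/imsetP[e eM ->]|vM] := boolP (v \in p @: M).
  apply/eqP/cards1P; exists e; apply/setP => f; rewrite !inE.
  apply/andP/eqP => [[/andP[_ /eqP fe] fM]|->]; first exact: injp.
  by rewrite eM (subsetP MF) /=.
apply/eqP; rewrite cards_eq0; apply/eqP/setP => f; rewrite !inE.
by apply: contraNF vM => /andP[/andP[_ /eqP <-]]; apply: imset_f.
Qed.

Definition ranking (V : finType) (p : E -> V) (r : E -> nat) F :=
  {in F &, forall e f, p e = p f -> r e = r f -> e = f}.

Definition preferred (V : finType) (p : E -> V) (r : E -> nat) F e :=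
  [set f in F | (p f == p e) && (r f < r e)].

(** The strict inequality makes a list as large as the greater end degree long enough for Galvin's
    argument. *)
Definition balanced (VX VY : finType) (px : E -> VX) (py : E -> VY) F :=
  exists rx ry, [/\ ranking px rx F, ranking py ry F &
    {in F, forall e, #|preferred px rx F e| + #|preferred py ry F e|
                     < maxn (deg px F (px e)) (deg py F (py e))}].

Lemma balanced_sym (VX VY : finType) (px : E -> VX) (py : E -> VY) F :
  balanced px py F -> balanced py px F.
Proof.
case=> rx [ry [rkx rky bal]]; exists ry, rx; split=> // e eF.
by rewrite addnC maxnC bal.
Qed.

(* The edges of [M] become the first choice of their [px]-ends and the last
   choice of their [py]-ends. *)
Lemma balanced_setDmatching (VX VY : finType) (px : E -> VX) (py : E -> VY)
    F M :
  M \subset F -> is_matching px py M ->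
  {in F, forall e, px e \in px @: M ->
      deg px F (px e) <= deg py F (py e) -> py e \in py @: M} ->
  balanced px py (F :\: M) -> balanced px py F.
Proof.
move=> MF [injx injy] sat [rx [ry [rkx rky bal]]].
pose N := (\max_e ry e).+1.
have ltN e : ry e < N by rewrite ltnS; apply: leq_bigmax.
exists (fun e => if e \in M then 0 else (rx e).+1).
exists (fun e => if e \in M then N else ry e); split.
- move=> e f eF fF; have [eM|eM] := ifP; have [fM|fM] := ifP => // pef.
    by move=> _; apply: injx.
  by case=> ref; apply: rkx; rewrite // inE ?eM ?fM.
- move=> e f eF fF; have [eM|eM] := ifP; have [fM|fM] := ifP => // pef ref.
  + exact: injy.
  + by have := ltN f; rewrite -ref ltnn.
  + by have := ltN e; rewrite ref ltnn.
  + by apply: rky; rewrite // inE ?eM ?fM.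
- move=> e eF; have [eM|eM] := boolP (e \in M).
    (* An edge of [M] has no rival at its [px]-end, and at its [py]-end all rivals but itself may be
       preferred. *)
    rewrite (_ : preferred px _ F e = set0) ?cards0 ?add0n; last first.
      by apply/setP => f; rewrite !inE eM ltn0 !andbF.
      apply: (@leq_trans (deg py F (py e))); last exact: leq_maxr.
      apply: proper_card; apply/properP; split.
        by apply/subsetP => f; rewrite !inE => /and3P[-> ->].
      by exists e; rewrite !inE eF eqxx // ltnn.
  (* If [px e] is matched, [e] gains at most one preferred edge. The larger degree grows too: either
     it is that of [px e], or [sat] makes [py e] matched as well. *)
  have eFM : e \in F :\: M by rewrite inE eM.
  have := bal e eFM; have := sat e eF.
  rewrite (deg_setDmatching _ MF injx) (deg_setDmatching _ MF injy).
  set rx' := fun f => if f \in M then 0 else _.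
  set ry' := fun f => if f \in M then _ else _.
  have lex : #|preferred px rx' F e|
      <= #|preferred px rx (F :\: M) e| + (px e \in px @: M).
    rewrite -(cardsID M) addnC leq_add //.
      apply: subset_leq_card; apply/subsetP => f; rewrite !inE.
      case/andP=> fM /and3P[-> ->]; rewrite /rx' (negPf fM) (negPf eM) ltnS.
      by move->.
    have degM := deg_setDmatching (px e) (subxx M) injx.
    rewrite setDv [X in _ = X + _]eq_card0 ?add0n in degM; last first.
      by move=> f; rewrite !inE.
    rewrite -degM; apply: subset_leq_card; apply/subsetP => f.
    by rewrite !inE => /andP[/and3P[_ -> _] ->].
  have ley : #|preferred py ry' F e| <= #|preferred py ry (F :\: M) e|.
    apply: subset_leq_card; apply/subsetP => f; rewrite !inE /ry' (negPf eM).
    case/and3P=> -> ->; case: ifP => //= _.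
    by rewrite ltnNge ltnW.
  lia.
Qed.

Lemma ltn_card_setD F M : M \subset F -> M != set0 -> #|F :\: M| < #|F|.
Proof.
rewrite -card_gt0 => MF M0; rewrite cardsD (setIidPr MF) ltn_subrL M0.
exact: leq_trans M0 (subset_leq_card MF).
Qed.

Lemma balanced_all (VX VY : finType) (px : E -> VX) (py : E -> VY) F :
  balanced px py F.
Proof.
have [n] := ubnP #|F|; elim: n F => // n IH F /ltnSE leFn.
have [->|F0] := eqVneq F set0.
  by exists (fun=> 0), (fun=> 0); split=> e; rewrite ?inE // => f; rewrite inE.
have IHM M : M \subset F -> M != set0 -> balanced px py (F :\: M).
  by move=> MF M0; apply: IH; apply: leq_trans leFn; apply: ltn_card_setD.
(* The images count only the vertices met by [F]; the larger side chooses the matching. *)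
have [leYX|/ltnW leXY] := leqP #|py @: F| #|px @: F|.
  have [M [MF M0 matM sat]] := exists_saturating_matching F0 leYX.
  exact: balanced_setDmatching sat (IHM M MF M0).
have [M [MF M0 matM sat]] := exists_saturating_matching F0 leXY.
exact/balanced_sym/(balanced_setDmatching MF matM sat)/balanced_sym/IHM.
Qed.

(** This is a stable matching in the sense of Gale and Shapley. An edge [e] beaten at its [py]-end
    by the first choice [f] of some [px]-end can be deleted. Once there is no such edge, the first
    choices of the [px]-ends form the kernel. *)
Lemma exists_kernel (VX VY : finType) (px : E -> VX) (py : E -> VY)
    (rx ry : E -> nat) F :
  ranking px rx F -> ranking py ry F ->
  exists K, [/\ K \subset F, is_matching px py K &
    {in F :\: K, forall e, exists2 k, k \in K &
        (k \in preferred px rx F e) || (k \in preferred py ry F e)}].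
Proof.
have [n] := ubnP #|F|; elim: n F => // n IH F /ltnSE leFn rkx rky.
pose top e := (e \in F) && [forall f in F, (px f == px e) ==> (rx e <= rx f)].
have [/existsP[e /existsP[f /and4P[eF topf pef ltr]]]|notop] := boolP
    [exists e, exists f, [&& e \in F, top f, py f == py e & ry f < ry e]].
  have De : F :\ e \subset F by apply: subD1set.
  have [|||K [KF matK domK]] := IH (F :\ e).
  - by move: leFn; rewrite (cardsD1 e) eF.
  - by move=> g h /(subsetP De) gF /(subsetP De) hF; apply: rkx.
  - by move=> g h /(subsetP De) gF /(subsetP De) hF; apply: rky.
  have [fF /forallP minf] := andP topf.
  exists K; split=> [||g]; rewrite ?(subset_trans KF De) //.
  rewrite !inE => /andP[gK gF].
  have [ge|ge] := eqVneq g e; last first.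
    have [|k kK domk] := domK g; first by rewrite !inE gK ge.
    by exists k => //; move: domk; rewrite !inE;
       case/orP=> /and3P[/andP[_ ->] -> ->]; rewrite ?orbT.
  have [fK|fK] := boolP (f \in K).
    by exists f => //; rewrite !inE fF ge pef ltr orbT.
  (* As a first choice, [f] can be dominated only at its [py]-end, and what beats [f] there also
     beats [e]. *)
  have [|k kK] := domK f.
    by rewrite !inE fK fF andbT; apply: contraTneq ltr => ->; rewrite ltnn.
  rewrite !inE => /orP[] /and3P[/andP[_ kF] pkf ltk].
    by have := minf k; rewrite kF pkf leqNgt ltk.
  exists k => //; rewrite !inE kF ge (eqP pkf) pef (ltn_trans ltk ltr).
  by rewrite orbT.
exists [set e | top e]; split.
- by apply/subsetP => e; rewrite inE => /andP[].
- have noty e f : e \in F -> top f -> py e = py f -> ry e <= ry f.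
    move=> eF topf pef; rewrite leqNgt; apply: contra notop => lt.
    apply/existsP; exists e; apply/existsP; exists f.
    by rewrite eF topf pef eqxx.
  split=> e f; rewrite !inE => tope topf pef;
    have [eF /forallP mine] := andP tope;
    have [fF /forallP minf] := andP topf.
    apply: rkx => //; apply/eqP; rewrite eqn_leq.
    have := mine f; have := minf e; rewrite eF fF pef eqxx /=.
    by move=> -> ->.
  by apply: rky => //; apply/eqP; rewrite eqn_leq !noty.
- move=> e; rewrite !inE => /andP[tope eF].
  have Pe : (e \in F) && (px e == px e) by rewrite eF eqxx.
  case: (arg_minnP (P := fun f => (f \in F) && (px f == px e)) rx Pe).
  move=> k /andP[kF pke] mink.
  have topk : top k.
    apply/andP; split=> //; apply/forallP => f; apply/implyP => fF.
    by apply/implyP => /eqP pfk; apply: mink; rewrite fF pfk.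
  exists k; rewrite ?inE // kF pke /= ltn_neqAle mink // andbT.
  apply/orP; left; apply: contra tope => /eqP rke.
  by rewrite -(rkx k e kF eF (eqP pke) rke).
Qed.

(** * List coloring of bipartite multigraphs *)

Section ListColoring.
Variables (C : finType) (adj : rel E).
Implicit Type L : E -> {set C}.

Definition is_list_coloring F L (c : E -> C) :=
  {in F, forall e, c e \in L e} /\
  {in F &, forall e f, e != f -> adj e f -> c e != c f}.

(** This gluing step serves both inductions: kernel against the rest, and the complement of a cut
    against the cut. *)
Lemma list_coloringU F1 F2 L c1 c2 : symmetric adj ->
  is_list_coloring F1 L c1 ->
  is_list_coloring F2 (fun e => L e :\: c1 @: [set f in F1 | adj e f]) c2 ->
  is_list_coloring (F1 :|: F2) L (fun e => if e \in F1 then c1 e else c2 e).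
Proof.
move=> adjC [L1 p1] [L2 p2]; split=> [e|e f]; rewrite !inE.
  by have [/L1//|_ /= /L2] := ifP; rewrite inE => /andP[].
have mixed g h : g \in F1 -> h \in F2 -> adj h g -> c1 g != c2 h.
  move=> g1 h2 hg; have := L2 h h2; rewrite inE => /andP[+ _].
  by apply: contraNneq => <-; apply: imset_f; rewrite inE g1.
have [e1 _|_ /= e2] := ifP; have [f1 _|_ /= f2] := ifP; first exact: p1.
- by move=> _ ef; apply: mixed; rewrite // adjC.
- by move=> _ ef; rewrite eq_sym; apply: mixed.
- exact: p2.
Qed.

End ListColoring.

Definition share_end (VX VY : finType) (px : E -> VX) (py : E -> VY) : rel E :=
  fun e f => (px e == px f) || (py e == py f).

(** Give one color [a] to a kernel of the edges whose lists contain [a], remove [a] from the lists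
    of adjacent edges, and use induction on the rest. *)
Lemma galvin (VX VY : finType) (px : E -> VX) (py : E -> VY)
    (rx ry : E -> nat) (C : finType) (c0 : C) F (L : E -> {set C}) :
  ranking px rx F -> ranking py ry F ->
  {in F, forall e, #|preferred px rx F e| + #|preferred py ry F e| < #|L e|} ->
  exists c, is_list_coloring (share_end px py) F L c.
Proof.
have [n] := ubnP #|F|; elim: n F L => // n IH F L /ltnSE leFn rkx rky ltL.
have [->|[e0 e0F]] := set_0Vmem F.
  by exists (fun=> c0); split=> e; rewrite ?inE // => f; rewrite inE.
have /card_gt0P[a aL] : 0 < #|L e0| by apply: leq_trans (ltL e0 e0F).
pose A := [set e in F | a \in L e].
have AF : A \subset F by apply/subsetP => e; rewrite inE => /andP[].
have subrk (V : finType) (p : E -> V) r F1 F2 :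
    F1 \subset F2 -> ranking p r F2 -> ranking p r F1.
  by move=> /subsetP F12 rk e f /F12 eF /F12 fF; apply: rk.
have [K [KA matK domK]] :=
  exists_kernel (subrk _ _ _ _ _ AF rkx) (subrk _ _ _ _ _ AF rky).
have KF := subset_trans KA AF.
have K0 : 0 < #|K|.
  apply/card_gt0P; have [e0K|e0K] := boolP (e0 \in K); first by exists e0.
  by have [|k kK _] := domK e0; [rewrite !inE e0K e0F aL|exists k].
have adjC : symmetric (share_end px py).
  by move=> e f; rewrite /share_end (eq_sym (px e)) (eq_sym (py e)).
have colK : is_list_coloring (share_end px py) K L (fun=> a).
  split=> [e /(subsetP KA)|e f eK fK nef]; first by rewrite inE => /andP[].
  case: matK => injx injy /orP[] /eqP.
    by move/injx => ef; rewrite ef ?eqxx in nef.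
  by move/injy => ef; rewrite ef ?eqxx in nef.
have DF : F :\: K \subset F by apply: subsetDl.
have [||||c colc] := IH (F :\: K)
    (fun e => L e :\: (fun=> a) @: [set f in K | share_end px py e f]).
- by apply: leq_trans leFn; apply: ltn_card_setD; rewrite // -card_gt0.
- exact: subrk rkx.
- exact: subrk rky.
- move=> e; rewrite inE => /andP[eK eF].
  have subp (V : finType) (p : E -> V) r :
      preferred p r (F :\: K) e \subset preferred p r F e.
    by apply/subsetP => f; rewrite !inE => /andP[/andP[_ ->]].
  have subpx := subset_leq_card (subp _ px rx).
  have subpy := subset_leq_card (subp _ py ry).
  have ltLe := ltL e eF.
  have [aLe|aLe] := boolP (a \in L e); last first.
    rewrite [L e :\: _](setDidPl _).
      exact: leq_ltn_trans (leq_add subpx subpy) ltLe.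
    rewrite disjoint_sym disjoint_subset.
    apply/subsetP => b /imsetP[_ _ ->].
    exact: aLe.
  have leL : #|L e|
      <= #|L e :\: (fun=> a) @: [set f in K | share_end px py e f]|.+1.
    rewrite (cardsD1 a) aLe add1n ltnS; apply: subset_leq_card.
    apply/subsetP => b; rewrite !inE => /andP[ba ->]; rewrite andbT.
    by apply: contra ba => /imsetP[_ _ ->].
  (* The lost color is paid for by a preferred edge [k] that leaves with the kernel. *)
  have [|k kK dom] := domK e; first by rewrite !inE eK eF.
  have kF := subsetP KF k kK.
  have ltp (V : finType) (p : E -> V) r : k \in preferred p r A e ->
      #|preferred p r (F :\: K) e| < #|preferred p r F e|.
    move=> kp; apply: proper_card; apply/properP; split; first exact: subp.
    by exists k; move: kp; rewrite !inE kF ?kK //= => /andP[].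
  rewrite -ltnS; apply: leq_ltn_trans (leq_trans ltLe leL).
  by case/orP: dom => /ltp lt; [rewrite -addSn|rewrite -addnS]; apply: leq_add.
have := list_coloringU adjC colK colc.
by rewrite -{1}(setIidPr KF) setID => colF; eexists; apply: colF.
Qed.

(** The sharpening of Galvin's theorem by Borodin, Kostochka and Woodall: each list is measured
    against the degrees at the ends of its own edge only. *)
Lemma bipartite_list_coloring (VX VY : finType) (px : E -> VX) (py : E -> VY)
    (C : finType) (c0 : C) F (L : E -> {set C}) :
  {in F, forall e, maxn (deg px F (px e)) (deg py F (py e)) <= #|L e|} ->
  exists c, is_list_coloring (share_end px py) F L c.
Proof.
move=> leL; have [rx [ry [rkx rky bal]]] := balanced_all px py F.
apply: (galvin c0 rkx rky) => e eF.
exact: leq_trans (bal e eF) (leL e eF).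
Qed.

End Bipartite.

(** * From bipartite to general multigraphs by maximum cuts *)

Section Multigraph.

Variable G : multigraph.
Implicit Types (F : {set edge G}) (e f : edge G) (v : vertex G).

Definition degree_in F v : nat := #|[set e in F | v \in ends e]|.

Definition adjacent : rel (edge G) := fun e f => ~~ [disjoint ends e & ends f].

Lemma exists_ends : exists x y : edge G -> vertex G,
  forall e, x e != y e /\ ends e = [set x e; y e].
Proof.
suff /fin_all_exists[x /fin_all_exists[y xy]] : forall e, exists x y,
    x != y /\ ends e = [set x; y] by exists x, y.
by move=> e; apply/cards2P; rewrite card_ends.
Qed.

Lemma degree_inID F1 F v : F1 \subset F ->
  degree_in F v = degree_in F1 v + degree_in (F :\: F1) v.
Proof.
move=> sF; rewrite /degree_in -(cardsID F1 [set e in F | v \in ends e]).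
congr (_ + _); apply: eq_card => e; rewrite !inE ?andbA //.
have [/(subsetP sF) ->|] := boolP (e \in F1); last by rewrite andbF.
by rewrite andbT.
Qed.

(* Moving [v] to the other side of a maximum cut does not enlarge it. *)
Lemma exists_max_cut (x y : edge G -> vertex G) F :
  (forall e, x e != y e /\ ends e = [set x e; y e]) ->
  exists A : {set vertex G},
    let H := [set e in F | (x e \in A) (+) (y e \in A)] in
    forall v, degree_in (F :\: H) v <= degree_in H v.
Proof.
move=> xyP.
pose cut (A : {set vertex G}) := [set e in F | (x e \in A) (+) (y e \in A)].
case: (arg_maxnP (P := predT) (fun A => #|cut A|) (isT : predT set0)).
move=> A _ maxA.
exists A => /= v; rewrite -/(cut A).
pose Iv := [set e : edge G | v \in ends e].
have := maxA [set z | (z \in A) (+) (z == v)] isT.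
set A' := [set z | _].
(* As the ends of an edge are distinct, moving [v] changes the status of exactly the edges at
   [v]. *)
have cutA' e : (x e \in A') (+) (y e \in A') =
    (x e \in A) (+) (y e \in A) (+) (v \in ends e).
  have [nxy ->] := xyP e; rewrite !inE !(eq_sym _ v).
  have [vx|_] := eqVneq v (x e).
    by rewrite vx (negPf nxy); case: (x e \in A); case: (y e \in A).
  by case: (x e \in A); case: (y e \in A); case: (v == y e).
rewrite /= -(cardsID Iv (cut A')) -(cardsID Iv (cut A)).
rewrite (_ : cut A' :\: Iv = cut A :\: Iv); last first.
  apply/setP => e; rewrite [LHS]inE [RHS]inE [_ \in cut A']inE [_ \in cut A]inE.
  by rewrite cutA' inE; case: (v \in ends e); rewrite ?addbF.
rewrite leq_add2r => leI.
have -> : degree_in (cut A) v = #|cut A :&: Iv|.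
  by apply: eq_card => e; rewrite [LHS]inE [RHS]inE [_ \in Iv]inE.
apply: leq_trans leI; apply: subset_leq_card; apply/subsetP => e.
rewrite [_ \in _ :&: _]inE [_ \in Iv]inE [_ \in cut A']inE cutA'.
rewrite inE [_ \in F :\: _]inE [_ \in cut A]inE.
by case/andP=> /andP[+ eF] ev; rewrite eF ev andbT addbT.
Qed.

Lemma multigraph_list_coloring (C : finType) (c0 : C) F
    (L : edge G -> {set C}) :
  {in F, forall e u v, ends e = [set u; v] ->
     maxn (degree_in F u) (degree_in F v)
       + minn (degree_in F u) (degree_in F v) %/ 2 <= #|L e|} ->
  exists c, is_list_coloring adjacent F L c.
Proof.
have [x [y xyP]] := exists_ends.
have [n] := ubnP #|F|; elim: n F L => // n IH F L /ltnSE leFn leL.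
have [->|F0] := eqVneq F set0.
  by exists (fun=> c0); split=> e; rewrite ?inE // => f; rewrite inE.
have [A] := exists_max_cut F xyP; set H := [set e in F | _] => /= cutA.
have HF : H \subset F by apply/subsetP => e; rewrite inE => /andP[].
have H0 : H != set0.
  (* If the cut were empty, its degrees would be 0, and then so would those of its complement
     [F]. *)
  have [e0 e0F] := set0Pn _ F0; apply/eqP => H0.
  have := cutA (x e0); rewrite H0 setD0 /degree_in [X in _ <= X]eq_card0.
    rewrite leqn0 cards_eq0 => /eqP /setP /(_ e0).
    by rewrite !inE e0F (xyP e0).2 !inE eqxx.
  by move=> e; rewrite !inE.
have [||c1 col1] := IH (F :\: H) L.
- by apply: leq_trans leFn; apply: ltn_card_setD.
- move=> e /setDP[eF _] u v euv; have := leL e eF u v euv.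
  have := degree_inID u HF; have := degree_inID v HF; lia.
(* Each cut edge is directed from [A] to its complement. *)
pose px e := if x e \in A then x e else y e.
pose py e := if x e \in A then y e else x e.
have endsP e : ends e = [set px e; py e].
  by rewrite /px /py (xyP e).2; case: ifP; rewrite // setUC.
have crossP e : e \in H -> (px e \in A) && (py e \notin A).
  by rewrite inE /px /py => /andP[_];
    case: (boolP (x e \in A)) => [->|/negPf ->] //= ->.
have adjC : symmetric adjacent by move=> e f; rewrite /adjacent disjoint_sym.
have [|c2 [L2 p2]] := bipartite_list_coloring (px := px) (py := py) c0 (F := H)
    (L := fun e => L e :\: c1 @: [set f in F :\: H | adjacent e f]).
  move=> e eH; have eF := subsetP HF e eH.
  have := leL e eF _ _ (endsP e).
  have := degree_inID (px e) HF; have := degree_inID (py e) HF.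
  have := cutA (px e); have := cutA (py e).
  have : deg px H (px e) <= degree_in H (px e).
    apply: subset_leq_card; apply/subsetP => f; rewrite !inE.
    by case/andP=> -> /eqP <-; rewrite endsP set21.
  have : deg py H (py e) <= degree_in H (py e).
    apply: subset_leq_card; apply/subsetP => f; rewrite !inE.
    by case/andP=> -> /eqP <-; rewrite endsP set22.
  have : #|L e| <= #|L e :\: c1 @: [set f in F :\: H | adjacent e f]|
           + (degree_in (F :\: H) (px e) + degree_in (F :\: H) (py e)).
    rewrite -(cardsID (c1 @: [set f in F :\: H | adjacent e f]) (L e)).
    rewrite addnC leq_add2l.
    apply: leq_trans (subset_leq_card (subsetIr _ _)) _.
    apply: leq_trans (leq_imset_card _ _) _.
    rewrite -cardsUI; apply: leq_trans (leq_addr _ _).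
    apply: subset_leq_card; apply/subsetP => f; rewrite inE => /andP[fFH].
    case/pred0Pn => z /andP[/= + zf]; rewrite endsP => /set2P[] zE.
      by apply/setUP; left; rewrite inE fFH -zE.
    by apply/setUP; right; rewrite inE fFH -zE.
  (* Let [d] be the degree in [F] and [r] the degree outside the cut, so [r <= d %/ 2]. A cut edge
     [uv] loses at most [r u + r v] colors and must keep [d u - r u], so [d u + d v %/ 2] colors
     suffice, and likewise with [u] and [v] exchanged. Both sums are at most the assumed bound. *)
  lia.
have col2 : is_list_coloring adjacent H
    (fun e => L e :\: c1 @: [set f in F :\: H | adjacent e f]) c2.
  (* Cut edges can meet only on the same side of the cut, so adjacency implies [share_end]. *)
  split=> // e f eH fH nef /pred0Pn[z /andP[/= ze zf]]; apply: p2 => //.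
  have /andP[pxe pye] := crossP e eH; have /andP[pxf pyf] := crossP f fH.
  move: ze zf; rewrite !endsP !inE /share_end.
  case/orP=> /eqP-> /orP[] // /eqP E; rewrite ?E ?eqxx ?orbT //.
    by rewrite E (negPf pyf) in pxe.
  by rewrite E pxf in pye.
have := list_coloringU adjC col1 col2.
by rewrite setUC -{1}(setIidPr HF) setID => colF; eexists; apply: colF.
Qed.

(** * Labels as forbidden colors *)

Lemma degree_inT v : degree_in setT v = degree v.
Proof. by apply: eq_card => e; rewrite !inE. Qed.

Lemma avoiding_colorable_of_bound (t : vertex G -> nat)
    (c : vertex G -> set nat) (m : nat) :
  t_labeling t c ->
  (forall e u v, ends e = [set u; v] ->
     maxn (degree u) (degree v) + minn (degree u) (degree v) %/ 2 + t u + t v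
       <= m) ->
  avoiding_colorable c m.
Proof.
move=> tc lem.
pose bad v (k : 'I_m.+1) := `[< c v k >].
(* Excluding [ord0] leaves the colors from 1 to [m], while keeping it in the type provides a default
   color even when [m] is 0. *)
pose L e := [set k : 'I_m.+1 | (k != ord0) && [forall v in ends e, ~~ bad v k]].
have card_bad v : #|[set k | bad v k]| <= t v.
  have [_ cv] := tc v; rewrite cardE -(size_map val).
  apply: size_uniq_card_le cv _ _.
    by rewrite (map_inj_uniq val_inj) enum_uniq.
  by move=> k /mapP[i + ->]; rewrite mem_enum inE => /asboolP.
have [|col [colL colP]] :=
  multigraph_list_coloring (ord0 : 'I_m.+1) (F := setT) (L := L).
  move=> e _ u v euv; rewrite !degree_inT.
  have := lem e u v euv; have := card_bad u; have := card_bad v.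
  (* Every nonzero color missing from [L e] is in the label of [u] or of [v]. *)
  have : m <= #|L e| + (#|[set k | bad u k]| + #|[set k | bad v k]|).
    rewrite -ltnS -[X in X <= _](card_ord m.+1) -cardsT.
    rewrite (cardsD1 ord0) inE add1n ltnS.
    rewrite -(cardsID (L e)) leq_add //; first exact/subset_leq_card/subsetIr.
    rewrite -cardsUI; apply: leq_trans (leq_addr _ _).
    apply: subset_leq_card; apply/subsetP => k; rewrite !inE.
    case/andP=> + /andP[k0 _]; rewrite k0 negb_forall => /existsP[z].
    rewrite negb_imply negbK euv !inE.
    by case/andP=> /orP[] /eqP-> ->; rewrite ?orbT.
  lia.
exists (fun e => val (col e)); split; first split.
- move=> e; have := colL e (in_setT e); rewrite inE => /andP[k0 _].
  by rewrite lt0n k0 -ltnS ltn_ord.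
- move=> e f v /eqP nef ve vf /ord_inj /eqP; apply/negP.
  apply: colP; rewrite ?inE //; apply/pred0Pn; exists v; exact/andP.
- move=> e [v /= ve cv]; have := colL e (in_setT e); rewrite inE.
  by case/andP=> _ /forallP /(_ v); rewrite ve => /asboolP.
Qed.

Lemma t_chromatic_index_le (t : vertex G -> nat) (m : nat) :
  (forall e u v, ends e = [set u; v] ->
     maxn (degree u) (degree v) + minn (degree u) (degree v) %/ 2 + t u + t v
       <= m) ->
  t_chromatic_index t <= m.
Proof.
move=> lem; have [[c tc <-] _] := t_chromatic_indexP t.
have [_] := c_chromatic_indexP tc; apply.
exact: avoiding_colorable_of_bound tc lem.
Qed.

End Multigraph.

Theorem theorem2p2 (G : multigraph) (t : vertex G -> nat) :
  t_chromatic_index t <=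
    \max_(uv : vertex G * vertex G | joined uv.1 uv.2)
      (maxn (degree uv.1) (degree uv.2)
       + (minn (degree uv.1) (degree uv.2)) %/ 2 + t uv.1 + t uv.2)
  /\
  (forall k : nat, (forall v : vertex G, t v = k) ->
    t_chromatic_index t <= (3 * max_degree G) %/ 2 + 2 * k).
Proof.
split=> [|k tk]; apply: t_chromatic_index_le => e u v euv.
  apply: (@leq_bigmax_cond _ _ _ (u, v)).
  by apply/existsP; exists e; rewrite euv.
have degle (w : vertex G) : degree w <= max_degree G by apply: leq_bigmax.
(* With [D] the maximal degree, the bound rests on [D + D %/ 2 = (3 * D) %/ 2]. *)
rewrite !tk; have := degle u; have := degle v; lia.
Qed.
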